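(* Let $m\in\{0,\dots,N_x-1\}$ and let $v_k\in\mathbb R^{N_v}$ satisfy $Av_k=\lambda_kv_k$, $\|v_k\|_2=1$. If $U^n=x_mv_k^T$, then one step of the DtP--PSI scheme (defined in the context) gives $$U^{n+1}=g^{\rm DtP}_{m,k}U^n,\qquad g^{\rm DtP}_{m,k}=p_{m,k}^2(2-p_{m,k}),$$ with $$p_{m,k}:=1-\nu y_m-i\nu_kz_m,\qquad \nu_k:=\lambda_k\frac{\Delta t}{\Delta x}.$$ Consequently, $$|g^{\rm DtP}_{m,k}|^2=\bigl((1-\nu y_m)^2+\nu_k^2z_m^2\bigr)^2\bigl((1+\nu y_m)^2+\nu_k^2z_m^2\bigr).$$ If, in addition, $|\lambda_k|=\lambda_{\max}$, then $|\nu_k|=\nu$ and $$|g^{\rm DtP}_{m,k}|^2=h_{\rm DtP}(y_m,\nu),\qquad h_{\rm DtP}(y,\nu):=\bigl[1+2y\nu(\nu-1)\bigr]^2\bigl[1+2y\nu(\nu+1)\bigr].$$ Moreover, $h_{\rm DtP}(y,\nu)\le 1$ for all $y\in[0,2]$ when $0\le\nu\le\frac13$, whereas $h_{\rm DtP}(y,\nu)>1$ for all sufficiently small $y>0$ when $\nu>\frac13$.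
   Context: Let $A\in\mathbb R^{N_v\times N_v}$ be symmetric, $\lambda_{\max}:=\|A\|_2$ (spectral norm), $\Delta t,\Delta x>0$, and $\nu:=\lambda_{\max}\frac{\Delta t}{\Delta x}>0$. Let $E_+,E_-\in\mathbb R^{N_x\times N_x}$ be the periodic shift matrices $(E_+w)_j=w_{j+1}$, $(E_-w)_j=w_{j-1}$ (indices modulo $N_x$), and $M_1=E_+-E_-$, $M_2=2I-E_+-E_-$. For $m=0,\dots,N_x-1$ the Fourier mode $x_m\in\mathbb C^{N_x}$ is $(x_m)_j:=\frac{1}{\sqrt{N_x}}e^{ij\alpha_m}$, $\alpha_m:=\frac{2\pi m}{N_x}$, $j=1,\dots,N_x$, and $y_m:=1-\cos\alpha_m$, $z_m:=\sin\alpha_m$. Set $$F_{\rm LF}(U):=-\frac{1}{2\Delta x}M_1UA-\frac{\lambda_{\max}}{2\Delta x}M_2U .$$ DtP--PSI scheme of rank $r$: from $U^n=X^nS^n(V^n)^T$, with $X^n$ ($N_x\times r$) and $V^n$ ($N_v\times r$) having orthonormal columns, one step is: K-step: $K^n=X^nS^n$, $K^{n+1}=K^n+\Delta t\,F_{\rm LF}(K^n(V^n)^T)V^n$; take a QR factorization $K^{n+1}=X^{n+1}S^{(1)}$ with $X^{n+1}$ having orthonormal columns. S-step: $S^{(2)}=S^{(1)}-\Delta t\,(X^{n+1})^*F_{\rm LF}(X^{n+1}S^{(1)}(V^n)^T)V^n$. L-step: $L^n=S^{(2)}(V^n)^T$, $L^{n+1}=L^n+\Delta t\,(X^{n+1})^*F_{\rm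 LF}(X^{n+1}L^n)$; take a QR factorization $(L^{n+1})^T=V^{n+1}(S^{n+1})^T$. Then $U^{n+1}=X^{n+1}L^{n+1}$. Here $X^*$ denotes the conjugate transpose (equal to $X^T$ for real factors). For the single-mode state $U^n=x_mv_k^T$ the scheme is run with $r=1$, $X^n=x_m$, $S^n=1$, $V^n=v_k$, and complex entries are allowed in $X$, $S$ and $L$. *)

(* Defs.v *)
From HB Require Import structures.
From mathcomp Require Import all_boot all_order all_algebra.
From mathcomp Require Import spectral complex.
From mathcomp Require Import all_classical all_reals all_analysis.
Set Implicit Arguments.
Unset Strict Implicit.
Unset Printing Implicit Defensive.
Import Order.TTheory GRing.Theory Num.Theory.
Import numFieldNormedType.Exports.

Local Open Scope classical_set_scope.
Local Open Scope ring_scope.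
Local Open Scope complex_scope.
Local Open Scope sesquilinear_scope.

Definition l2norm (R : realType) (n : nat) (x : 'cV[R]_n) : R :=
  Num.sqrt (\sum_i x i 0 ^+ 2).

Definition spectral_norm (R : realType) (m n : nat) (A : 'M[R]_(m, n)) : R :=
  sup [set l2norm (A *m x) | x in [set x : 'cV[R]_n | l2norm x <= 1]].

Definition toC (R : realType) (m n : nat) (A : 'M[R]_(m, n)) : 'M[R[i]]_(m, n) :=
  map_mx (fun a : R => a%:C) A.

(* [ordS] and [ord_pred] are the cyclic successor and predecessor on ['I_n]. *)
Definition shiftp (R : realType) (n : nat) : 'M[R]_n :=
  \matrix_(i, j) (j == ordS i)%:R.

Definition shiftm (R : realType) (n : nat) : 'M[R]_n :=
  \matrix_(i, j) (j == ord_pred i)%:R.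

Definition M1 (R : realType) (n : nat) : 'M[R]_n := shiftp R n - shiftm R n.

Definition M2 (R : realType) (n : nat) : 'M[R]_n :=
  2 *: 1%:M - shiftp R n - shiftm R n.

Definition F_LF (R : realType) (Nx Nv : nat) (A : 'M[R]_Nv) (dx : R)
    (U : 'M[R[i]]_(Nx, Nv)) : 'M[R[i]]_(Nx, Nv) :=
  - ((1 / (2 * dx))%:C *: (toC (M1 R Nx) *m U *m toC A))
  - ((spectral_norm A / (2 * dx))%:C *: (toC (M2 R Nx) *m U)).

Definition orthonormal_cols (R : realType) (n r : nat) (Q : 'M[R[i]]_(n, r)) : Prop :=
  Q^t* *m Q = 1%:M.

(* Thin QR.  The diagonal of [T] is not normalised, and [B] may be rank
   deficient, so [Q] and [T] are not determined by [B].  [is_trig_mx] means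
   lower triangular. *)
Definition QR_factorization (R : realType) (n r : nat)
    (B Q : 'M[R[i]]_(n, r)) (T : 'M[R[i]]_r) : Prop :=
  [/\ orthonormal_cols Q, is_trig_mx T^T & B = Q *m T].

(* One step of the scheme, from the factors [X0, S0, V0] of [U0] to the factors
   [X1, S1, V1] and the new state [U1].  It is a relation because the QR
   factorizations are not unique.  [X] and [S] are complex, [V] is real. *)
Definition DtP_PSI_step (R : realType) (Nx Nv r : nat) (A : 'M[R]_Nv) (dt dx : R)
    (U0 : 'M[R[i]]_(Nx, Nv))
    (X0 : 'M[R[i]]_(Nx, r)) (S0 : 'M[R[i]]_r) (V0 : 'M[R]_(Nv, r))
    (X1 : 'M[R[i]]_(Nx, r)) (S1 : 'M[R[i]]_r) (V1 : 'M[R]_(Nv, r))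
    (U1 : 'M[R[i]]_(Nx, Nv)) : Prop :=
  [/\ orthonormal_cols X0, orthonormal_cols (toC V0),
      U0 = X0 *m S0 *m (toC V0)^T
    & exists (K0 K1 : 'M[R[i]]_(Nx, r)) (Sa Sb : 'M[R[i]]_r)
             (L0 L1 : 'M[R[i]]_(r, Nv)),
      [/\ K0 = X0 *m S0
          /\ K1 = K0 + dt%:C *: (F_LF A dx (K0 *m (toC V0)^T) *m toC V0),
          QR_factorization K1 X1 Sa,
          Sb = Sa - dt%:C *:
                 (X1^t* *m F_LF A dx (X1 *m Sa *m (toC V0)^T) *m toC V0),
          L0 = Sb *m (toC V0)^T
          /\ L1 = L0 + dt%:C *: (X1^t* *m F_LF A dx (X1 *m L0))
        & QR_factorization L1^T (toC V1) S1^T /\ U1 = X1 *m L1]].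

Definition alpha (R : realType) (Nx m : nat) : R := 2 * pi * m%:R / Nx%:R.

(* The components of the mode are numbered from 1 to [Nx], those of ['cV_Nx]
   from 0, hence [j.+1]; [cos t +i* sin t] is exp(i t). *)
Definition fourier_mode (R : realType) (Nx m : nat) : 'cV[R[i]]_Nx :=
  \col_j ((1 / Num.sqrt Nx%:R)%:C *
          (cos (j.+1%:R * alpha R Nx m) +i* sin (j.+1%:R * alpha R Nx m))).

Definition y_mode (R : realType) (Nx m : nat) : R := 1 - cos (alpha R Nx m).
Definition z_mode (R : realType) (Nx m : nat) : R := sin (alpha R Nx m).

Definition nu (R : realType) (Nv : nat) (A : 'M[R]_Nv) (dt dx : R) : R :=
  spectral_norm A * (dt / dx).

Definition nu_eig (R : realType) (lambda dt dx : R) : R := lambda * (dt / dx).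

Definition p_mode (R : realType) (Nx Nv m : nat) (A : 'M[R]_Nv)
    (lambda dt dx : R) : R[i] :=
  (1 - nu A dt dx * y_mode R Nx m) -i* (nu_eig lambda dt dx * z_mode R Nx m).

Definition g_DtP (R : realType) (Nx Nv m : nat) (A : 'M[R]_Nv)
    (lambda dt dx : R) : R[i] :=
  p_mode Nx m A lambda dt dx ^+ 2 * (2 - p_mode Nx m A lambda dt dx).

Definition h_DtP (R : realType) (y nu : R) : R :=
  (1 + 2 * y * nu * (nu - 1)) ^+ 2 * (1 + 2 * y * nu * (nu + 1)).

(* Main.v *)
Require Import Defs.
From mathcomp Require Import all_boot all_order all_algebra.
From mathcomp Require Import spectral complex.
From mathcomp Require Import ring lra.
From mathcomp Require Import all_classical all_reals all_analysis.
Set Implicit Arguments.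
Unset Strict Implicit.
Unset Printing Implicit Defensive.
Import Order.TTheory GRing.Theory Num.Theory.
Import numFieldNormedType.Exports.
Local Open Scope classical_set_scope.
Local Open Scope ring_scope.
Local Open Scope complex_scope.

(* The mode [x_m] is a common eigenvector of the two shifts, so [U0 = x_m v^T]
   is an eigenvector of [dt F_LF] for the eigenvalue [p - 1].  On any such
   state every projection in the scheme acts trivially: the K-step multiplies
   the state by [p], the S-step, where the sign of [F_LF] is reversed, by
   [1 - (p - 1) = 2 - p], and the L-step by [p] again.
   The threshold 1/3 is the sign change of the coefficient [2 nu (3 nu - 1)] of
   [y] in [h_DtP y nu - 1]. *)

Lemma scalerB1D (R : pzRingType) (V : lmodType R) (a : R) (u : V) :
  u + (a - 1) *: u = a *: u.
Proof. by rewrite scalerBl scale1r addrC subrK. Qed.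

(** * One step of the scheme on an eigenstate of [F_LF] *)

Section Scheme.
Variable R : realType.
Local Notation C := R[i].
Local Open Scope sesquilinear_scope.

Lemma toC_adjoint (m n : nat) (V : 'M[R]_(m, n)) : (toC V)^t* = (toC V)^T.
Proof. by apply/matrixP => i j; rewrite !mxE; apply: conjc_real. Qed.

Lemma F_LFZ (Nx Nv : nat) (A : 'M[R]_Nv) (dx : R) (c : C)
    (U : 'M[C]_(Nx, Nv)) : F_LF A dx (c *: U) = c *: F_LF A dx U.
Proof.
rewrite /F_LF -!scalemxAr -!scalemxAl !(scalerA _ c) !(mulrC _ c) -!scalerA.
by rewrite scalerBr scalerN.
Qed.

Lemma F_LF_eigenZ (Nx Nv : nat) (A : 'M[R]_Nv) (dt dx : R) (a c : C)
    (U : 'M[C]_(Nx, Nv)) :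
  dt%:C *: F_LF A dx U = a *: U ->
  dt%:C *: F_LF A dx (c *: U) = a *: (c *: U).
Proof.
move=> FU; rewrite F_LFZ scalerA (mulrC dt%:C) -scalerA FU !scalerA.
by rewrite (mulrC c).
Qed.

(** The QR factors enter through the product [X1 *m Sa], which [K1] fixes, and through the
    orthonormality of [X1]. Hence every choice of them gives the same [U1], even for [p = 0], when
    [K1] vanishes. *)
Lemma DtP_PSI_step_eigen (Nx Nv r : nat) (A : 'M[R]_Nv) (dt dx : R) (p : C)
    (U0 U1 : 'M[C]_(Nx, Nv)) (X0 X1 : 'M[C]_(Nx, r)) (S0 S1 : 'M[C]_r)
    (V0 V1 : 'M[R]_(Nv, r)) :
  dt%:C *: F_LF A dx U0 = (p - 1) *: U0 ->
  DtP_PSI_step A dt dx U0 X0 S0 V0 X1 S1 V1 U1 ->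
  U1 = (p ^+ 2 * (2 - p)) *: U0.
Proof.
move=> FU0 [_]; rewrite /orthonormal_cols toC_adjoint => VV U0E.
case=> K0 [K1] [Sa] [Sb] [L0] [L1] [[-> ->] [X1X1 _]].
rewrite /orthonormal_cols in X1X1.
rewrite -U0E => K1E SbE [L0E L1E] [_ ->].
have FZ c := F_LF_eigenZ c FU0.
(* K-step: multiplying [U0] by [toC V0] gives back [X0 *m S0], because [V0] has orthonormal
   columns. *)
have X1Sa : X1 *m Sa = p *: (X0 *m S0).
  rewrite -K1E scalemxAl FU0 -scalemxAl U0E -mulmxA VV mulmx1.
  exact: scalerB1D.
have X1SaV : X1 *m Sa *m (toC V0)^T = p *: U0 by rewrite X1Sa -scalemxAl -U0E.
(* S-step: the state is now [p *: U0], still an eigenstate, so the two projections together return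
   [(p - 1) *: Sa], which is subtracted. *)
have SbSa : Sb = (2 - p) *: Sa.
  rewrite SbE -mulmxA scalemxAr scalemxAl X1SaV FZ -X1SaV.
  rewrite -scalemxAl -!mulmxA VV mulmx1 -scalemxAr mulmxA X1X1 mul1mx.
  by rewrite -[X in X - _]scale1r -scalerBl opprB addrA.
have X1L0 : X1 *m L0 = ((2 - p) * p) *: U0.
  by rewrite L0E SbSa mulmxA -scalemxAr -scalemxAl X1SaV scalerA.
have L1L0 : L1 = p *: L0.
  rewrite L1E scalemxAr X1L0 FZ -X1L0 -scalemxAr mulmxA X1X1 mul1mx.
  by rewrite scalerB1D.
by rewrite L1L0 -scalemxAr X1L0 scalerA mulrCA mulrC expr2 (mulrC p).
Qed.

End Scheme.

(** * Fourier modes as common eigenvectors of the cyclic shifts *)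

Lemma mulmx_reindex (R : realType) (n : nat) (f : 'I_n -> 'I_n)
    (x : 'cV[R[i]]_n) :
  toC (\matrix_(i, j) (j == f i)%:R) *m x = \col_i x (f i) 0.
Proof.
apply/matrixP => i j; rewrite ord1 !mxE (bigD1 (f i))//= big1 => [|k /negbTE ki].
  by rewrite !mxE eqxx mul1r addr0.
by rewrite !mxE ki mul0r.
Qed.

Lemma expiD (R : realType) (s t : R) :
  cos (s + t) +i* sin (s + t) = (cos s +i* sin s) * (cos t +i* sin t).
Proof. by rewrite cosD sinD (addrC (sin s * _)). Qed.

(** De Moivre's formula; it turns the entries of a mode into powers of a single root of unity. *)
Lemma expiX (R : realType) (t : R) (k : nat) :
  cos (k%:R * t) +i* sin (k%:R * t) = (cos t +i* sin t) ^+ k.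
Proof.
elim: k => [|k IHk]; first by rewrite mul0r cos0 sin0 expr0.
by rewrite -natr1 mulrDl mul1r expiD IHk exprSr.
Qed.

Section FourierMode.
Variables (R : realType) (Nx m : nat).
Hypothesis m_lt : (m < Nx)%N.
Local Notation C := R[i].
Let w : C := cos (alpha R Nx m) +i* sin (alpha R Nx m).
Let x : 'cV[C]_Nx := fourier_mode R Nx m.

Let w_conj : w * w^* = 1.
Proof. by rewrite -sqr_normc normc_def /= cos2Dsin2 sqrtr1 expr1n. Qed.

Let w_unity : w ^+ Nx = 1.
Proof.
rewrite /w -expiX /alpha.
have -> : Nx%:R * (2 * pi * m%:R / Nx%:R) = m%:R * (pi *+ 2) :> R.
  rewrite -[pi *+ 2]mulr_natl; field.
  by rewrite pnatr_eq0 -lt0n (leq_trans _ m_lt).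
by rewrite expiX cos2pi sin2pi expr1n.
Qed.

Let fourier_modeE j : x j 0 = (1 / Num.sqrt Nx%:R)%:C * w ^+ j.+1.
Proof. by rewrite mxE expiX. Qed.

Let fourier_mode_ordS j : x (ordS j) 0 = w * x j 0.
(* [ordS j] has value [j.+1 %% Nx]; once one factor [w] is split off, [w ^+ Nx = 1] absorbs the
   wrap-around. *)
Proof. by rewrite !fourier_modeE exprS expr_mod// mulrCA. Qed.

Let fourier_mode_ord_pred j : x (ord_pred j) 0 = w^* * x j 0.
Proof.
(* Writing [j] as the successor of [ord_pred j] reduces to the forward shift; [w^*] inverts [w]. *)
rewrite -{2}[j]ord_predK fourier_mode_ordS mulrA (mulrC w^*) w_conj.
by rewrite mul1r.
Qed.

Lemma shiftp_fourier_mode : toC (shiftp R Nx) *m x = w *: x.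
Proof.
rewrite mulmx_reindex; apply/matrixP => i j.
by rewrite ord1 [LHS]mxE fourier_mode_ordS [RHS]mxE.
Qed.

Lemma shiftm_fourier_mode : toC (shiftm R Nx) *m x = w^* *: x.
Proof.
rewrite mulmx_reindex; apply/matrixP => i j.
by rewrite ord1 [LHS]mxE fourier_mode_ord_pred [RHS]mxE.
Qed.

Lemma fourier_mode_orthonormal : orthonormal_cols x.
Proof.
have Nx_gt0 : (0 < Nx)%N by exact: leq_trans m_lt.
apply/matrixP => i j; rewrite !ord1 [LHS]mxE [RHS]mxE eqxx.
(* Every entry has squared modulus 1 / Nx, since [w] lies on the unit circle. *)
rewrite (eq_bigr (fun=> (Nx%:R^-1)%:C)) => [|k _].
  rewrite sumr_const card_ord -rmorphMn/= -[_ *+ _]mulr_natl mulfV//.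
  by rewrite pnatr_eq0 -lt0n.
have -> : (x^t*)%sesqui 0 k = (x k 0)^* by rewrite !mxE.
rewrite mulrC -sqr_normc fourier_modeE normrM normrX exprMn.
have -> : `|w| = 1 by rewrite normc_def /= cos2Dsin2 sqrtr1.
rewrite expr1n expr1n mulr1 normc_def /= expr0n addr0 sqrtr_sqr -rmorphXn /=.
by rewrite real_normK ?num_real// div1r exprVn sqr_sqrtr// ler0n.
Qed.

(** The eigenvalue is [w - w^*], that is, 2i times the imaginary part of [w]. *)
Lemma M1_fourier_mode :
  toC (M1 R Nx) *m x = (0 +i* (2 * z_mode R Nx m)) *: x.
Proof.
have -> : toC (M1 R Nx) = toC (shiftp R Nx) - toC (shiftm R Nx).
  by rewrite /toC /M1 map_mxB.
rewrite mulmxBl shiftp_fourier_mode shiftm_fourier_mode -scalerBl.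
congr (_ *: _); apply/eqP; rewrite eq_complex /= /z_mode.
by apply/andP; split; apply/eqP; ring.
Qed.

Lemma M2_fourier_mode : toC (M2 R Nx) *m x = (2 * y_mode R Nx m)%:C *: x.
Proof.
have -> : toC (M2 R Nx) = 2 *: 1%:M - toC (shiftp R Nx) - toC (shiftm R Nx).
  apply/matrixP => i j; rewrite !mxE !rmorphB /= rmorphM /= rmorph_nat.
  by rewrite rmorph_nat.
rewrite !mulmxBl -scalemxAl mul1mx shiftp_fourier_mode shiftm_fourier_mode.
rewrite -!scalerBl; congr (_ *: _); apply/eqP; rewrite eq_complex /= /y_mode.
by apply/andP; split; apply/eqP; ring.
Qed.

Lemma F_LF_fourier_mode (Nv : nat) (A : 'M[R]_Nv) (v : 'cV[R]_Nv)
    (lambda dt dx : R) :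
  A^T = A -> dx != 0 -> A *m v = lambda *: v ->
  dt%:C *: F_LF A dx (x *m (toC v)^T) =
    (p_mode Nx m A lambda dt dx - 1) *: (x *m (toC v)^T).
Proof.
move=> symA dx0 Av.
(* Symmetry of [A] makes the right eigenvector [v] a left one. *)
have vA : (toC v)^T *m toC A = lambda%:C *: (toC v)^T.
  by rewrite -[in toC A]symA /toC -map_trmx -trmx_mul -map_mxM Av map_mxZ linearZ.
rewrite /F_LF !mulmxA M1_fourier_mode M2_fourier_mode -!scalemxAl -mulmxA vA.
rewrite -scalemxAr !scalerA -scaleNr -scalerBl scalerA; congr (_ *: _).
apply/eqP; rewrite eq_complex /= /nu /nu_eig.
by apply/andP; split; apply/eqP; field.
Qed.

End FourierMode.

(** * The polynomial [h_DtP] and its threshold *)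

Lemma h_DtP_sub1 (R : realType) (y nu0 : R) :
  h_DtP y nu0 - 1 = 2 * y * nu0 *
    (3 * nu0 - 1 - 2 * y * nu0 * (1 - nu0) * (1 + 3 * nu0)
     + (2 * y * nu0 * (1 - nu0)) ^+ 2 * (1 + nu0)).
Proof. by rewrite /h_DtP; ring. Qed.

Lemma h_DtP_le1 (R : realType) (y nu0 : R) :
  0 <= nu0 <= 1 / 3 -> 0 <= y <= 2 -> h_DtP y nu0 <= 1.
Proof.
move=> /andP[nu0_ge0 nu0_le] /andP[y_ge0 y_le2].
rewrite -subr_le0 h_DtP_sub1 mulr_ge0_le0 ?mulr_ge0 //.
have t_ge0 : 0 <= 2 * y * nu0 by rewrite !mulr_ge0.
have t_le : 2 * y * nu0 <= 4 * nu0 by rewrite ler_wpM2r//; lra.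
set t := 2 * y * nu0 in t_ge0 t_le *.
have s_ge0 : 0 <= t * (1 - nu0) by rewrite mulr_ge0//; lra.
(* The chain is t (1 - nu0^2) <= t <= 4 nu0 <= 1 + 3 nu0. It makes the term of the bracket linear in
   [t] outweigh the quadratic one. *)
have s_le : t * (1 - nu0) * (1 + nu0) <= 1 + 3 * nu0.
  have -> : t * (1 - nu0) * (1 + nu0) = t - t * nu0 ^+ 2 by ring.
  by have := mulr_ge0 t_ge0 (sqr_ge0 nu0); lra.
have : t * (1 - nu0) * (t * (1 - nu0) * (1 + nu0)) <=
       t * (1 - nu0) * (1 + 3 * nu0) by rewrite ler_wpM2l.
by rewrite expr2 -(mulrA (t * (1 - nu0))); lra.
Qed.

Lemma h_DtP_gt1 (R : realType) (nu0 : R) : 1 / 3 < nu0 ->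
  exists2 delta : R, 0 < delta & forall y, 0 < y < delta -> 1 < h_DtP y nu0.
Proof.
move=> nu0_gt; set c := 2 * nu0 * (1 - nu0) * (1 + 3 * nu0).
have c1_gt0 : 0 < 1 + c ^+ 2 by have := sqr_ge0 c; lra.
(* The bracket in [h_DtP_sub1] is at least [3 * nu0 - 1 - y * c]. Since [c <= 0] once [nu0 >= 1],
   the division is by the positive upper bound [1 + c ^+ 2] of [c]. *)
exists ((3 * nu0 - 1) / (1 + c ^+ 2)) => [|y /andP[y_gt0]].
  by rewrite divr_gt0//; lra.
rewrite ltr_pdivlMr// => y_lt.
have c_le : c <= 1 + c ^+ 2 by have := sqr_ge0 (c - 1 / 2); lra.
have yc_le : y * c <= y * (1 + c ^+ 2) by rewrite ler_wpM2l// ltW.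
rewrite -subr_gt0 h_DtP_sub1 mulr_gt0//; first by rewrite !mulr_gt0//; lra.
have q_ge0 : 0 <= (2 * y * nu0 * (1 - nu0)) ^+ 2 * (1 + nu0).
  by rewrite mulr_ge0 ?sqr_ge0//; lra.
have -> : 2 * y * nu0 * (1 - nu0) * (1 + 3 * nu0) = y * c by rewrite /c; ring.
lra.
Qed.

(** * Existence of a step, and the modulus of the amplification factor *)

Lemma DtP_PSI_step_rank1 (R : realType) (Nx Nv : nat) (A : 'M[R]_Nv)
    (dt dx : R) (x : 'cV[R[i]]_Nx) (v : 'cV[R]_Nv) (p : R[i]) :
  orthonormal_cols x -> orthonormal_cols (toC v) ->
  dt%:C *: F_LF A dx (x *m (toC v)^T) = (p - 1) *: (x *m (toC v)^T) ->
  exists X1 S1 V1 U1,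
    DtP_PSI_step A dt dx (x *m (toC v)^T) x 1%:M v X1 S1 V1 U1.
Proof.
move=> xx vv FU.
have vTv : (toC v)^T *m toC v = 1%:M by rewrite -toC_adjoint.
have FZ c := F_LF_eigenZ c FU.
pose g := (2 - p) * p ^+ 2.
(* [x] and [v] stay the orthonormal factors. The 1 x 1 cores, trivially triangular, carry the
   scalars: [p] after the K-step, [(2 - p) * p] after the S-step, [g] after the L-step. *)
exists x, g%:M, v, (g *: (x *m (toC v)^T)); split; rewrite ?mulmx1//.
exists x, (p *: x), p%:M, ((2 - p) * p)%:M, (((2 - p) * p) *: (toC v)^T),
  (g *: (toC v)^T).
split.
- split=> //.
  by rewrite scalemxAl FU -scalemxAl -mulmxA vTv mulmx1 scalerB1D.
- by split=> //; [rewrite tr_scalar_mx scalar_mx_is_trig | rewrite mul_mx_scalar].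
- rewrite mul_mx_scalar -scalemxAl (scalemxAl dt%:C) (scalemxAr dt%:C) FZ.
  rewrite -!(scalemxAr, scalemxAl) mulmxA xx mul1mx vTv.
  by rewrite !scale_scalar_mx -raddfB /=; congr _%:M; ring.
- split; first by rewrite mul_scalar_mx.
  rewrite [in RHS]scalemxAr -[X in F_LF _ _ X]scalemxAr FZ -!scalemxAr mulmxA.
  by rewrite xx mul1mx scalerB1D scalerA /g; congr (_ *: _); ring.
- split; last by rewrite -scalemxAr.
  split=> //; first by rewrite trmxK scalar_mx_is_trig.
  by rewrite tr_scalar_mx mul_mx_scalar linearZ /= trmxK.
Qed.

Lemma orthonormal_cols_toC (R : realType) (n : nat) (v : 'cV[R]_n) :
  l2norm v = 1 -> orthonormal_cols (toC v).
Proof.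
move=> v1; rewrite /orthonormal_cols toC_adjoint /toC map_trmx -map_mxM.
rewrite -[RHS](map_mx1 (real_complex R)); congr map_mx.
apply/matrixP => i j; rewrite !ord1 !mxE eqxx -[RHS](expr1n _ 2) -v1.
rewrite /l2norm sqr_sqrtr ?sumr_ge0// => [|k _]; last exact: sqr_ge0.
by apply: eq_bigr => k _; rewrite mxE expr2.
Qed.

(** Passing from p to 2 - p turns the real part 1 - nu y into 1 + nu y and flips the sign of the
    imaginary part; the squared modulus is |p|^4 |2 - p|^2. *)
Lemma sqr_norm_g_DtP (R : realType) (Nx Nv m : nat) (A : 'M[R]_Nv)
    (lambda dt dx : R) :
  `|g_DtP Nx m A lambda dt dx| ^+ 2 =
    (((1 - nu A dt dx * y_mode R Nx m) ^+ 2
       + nu_eig lambda dt dx ^+ 2 * z_mode R Nx m ^+ 2) ^+ 2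
     * ((1 + nu A dt dx * y_mode R Nx m) ^+ 2
       + nu_eig lambda dt dx ^+ 2 * z_mode R Nx m ^+ 2))%:C.
Proof.
rewrite /g_DtP normrM normrX exprMn exprAC -!add_Re2_Im2 /p_mode /=.
rewrite -rmorphXn -rmorphM; congr _%:C.
ring.
Qed.

(** This is sin^2 = (1 - cos)(1 + cos), used to eliminate [z_mode]. *)
Lemma y_mode_z_mode (R : realType) (Nx m : nat) :
  z_mode R Nx m ^+ 2 = y_mode R Nx m * (2 - y_mode R Nx m).
Proof. by rewrite /y_mode /z_mode sin2cos2; ring. Qed.

Theorem proposition3p2 (R : realType) :
  (forall (Nx Nv : nat) (A : 'M[R]_Nv) (dt dx : R) (m : nat)
          (v : 'cV[R]_Nv) (lambda : R),
    A^T = A -> 0 < dt -> 0 < dx -> 0 < nu A dt dx ->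
    (m < Nx)%N -> A *m v = lambda *: v -> l2norm v = 1 ->
    let U0 : 'M[R[i]]_(Nx, Nv) := fourier_mode R Nx m *m (toC v)^T in
    let g : R[i] := g_DtP Nx m A lambda dt dx in
    [/\ (exists X1 S1 V1 U1,
           DtP_PSI_step A dt dx U0 (fourier_mode R Nx m) 1%:M v X1 S1 V1 U1),
        (forall X1 S1 V1 U1,
           DtP_PSI_step A dt dx U0 (fourier_mode R Nx m) 1%:M v X1 S1 V1 U1 ->
           U1 = g *: U0),
        `|g| ^+ 2 =
          (((1 - nu A dt dx * y_mode R Nx m) ^+ 2
             + nu_eig lambda dt dx ^+ 2 * z_mode R Nx m ^+ 2) ^+ 2
           * ((1 + nu A dt dx * y_mode R Nx m) ^+ 2
             + nu_eig lambda dt dx ^+ 2 * z_mode R Nx m ^+ 2))%:C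
      & `|lambda| = spectral_norm A ->
          `|nu_eig lambda dt dx| = nu A dt dx
          /\ `|g| ^+ 2 = (h_DtP (y_mode R Nx m) (nu A dt dx))%:C])
  /\ (forall nu0 : R, 0 <= nu0 <= 1 / 3 ->
        forall y : R, 0 <= y <= 2 -> h_DtP y nu0 <= 1)
  /\ (forall nu0 : R, 1 / 3 < nu0 ->
        exists2 delta : R, 0 < delta &
          forall y : R, 0 < y < delta -> 1 < h_DtP y nu0).
Proof.
split; last by split=> [nu0 nu0_le y|]; [exact: h_DtP_le1 | exact: h_DtP_gt1].
move=> Nx Nv A dt dx m v lambda symA dt_gt0 dx_gt0 nu_gt0 m_lt Av v1 U0 g.
have FU0 := F_LF_fourier_mode m_lt dt symA (lt0r_neq0 dx_gt0) Av.
split.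
- apply: DtP_PSI_step_rank1 FU0; first exact: fourier_mode_orthonormal.
  exact: orthonormal_cols_toC.
- by move=> X1 S1 V1 U1; exact: DtP_PSI_step_eigen FU0.
- exact: sqr_norm_g_DtP.
move=> lambda_max.
have nu_eigE : `|nu_eig lambda dt dx| = nu A dt dx.
  by rewrite normrM lambda_max ger0_norm// ltW// divr_gt0.
(* Only the square of nu_k enters, and it equals nu^2. Each factor then collapses: (1 -+ nu y)^2 +
   nu^2 y (2 - y) = 1 + 2 y nu (nu -+ 1). *)
split=> //; rewrite sqr_norm_g_DtP -(real_normK (num_real (nu_eig _ _ _))) nu_eigE.
by rewrite y_mode_z_mode /h_DtP; congr _%:C; ring.
Qed.
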